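(* Let $\mathrm L$ be a coatomic logic, $\Gamma$ a set of formulas, and $\overline\varphi$ a non-empty tuple of formulas. Then the rule $\Gamma\vdash\overline\varphi$ is antiadmissible in $\mathrm L$ if and only if $\Gamma\vdash_{\alpha_{\mathrm{Th}}(\mathrm L)}\overline\varphi$.
   Context: A logic $\mathrm{L}$ is given by an infinite set of variables, the absolutely free algebra of formulas $\mathbf{Fm}\,\mathrm L$ over it in some signature (with underlying set $\mathrm{Fm}\,\mathrm{L}$), and a relation $\Gamma \vdash_{\mathrm{L}} \varphi$ between sets of formulas and formulas which is reflexive, monotone, closed under cut (if $\Gamma \vdash_{\mathrm L} \varphi$ for all $\varphi\in\Phi$ and $\Phi \vdash_{\mathrm L} \psi$, then $\Gamma \vdash_{\mathrm L} \psi$) and structural (closed under substitutions, i.e. endomorphisms of $\mathbf{Fm}\,\mathrm L$). $\Gamma\vdash_{\mathrm L}\Phi$ (also for tuples) means $\Gamma\vdash_{\mathrm L}\varphi$ for all $\varphi$ in $\Phi$. A theory is a set of formulas closed under $\vdash_{\mathrm L}$; a theory is simple if it is maximal among theories different from $\mathrm{Fm}\,\mathrm L$. $\mathrm L$ is coatomic if every theory different from $\mathrm{Fm}\,\mathrm L$ is included in a simple theory. The semisimple companion $\alpha_{\mathrm{Th}}(\mathrm L)$ is the logic (over the same formulas) determined by the matrices $\langle\mathbf{Fm}\,\mathrm L,T\rangle$ with $T$ a simple theory of $\mathrm L$: $\Gamma\vdash_{\alpha_{\mathrm{Th}}(\mathrm L)}\varphi$ iff for every simple theory $T$ of $\mathrm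 L$ and every substitution $\sigma$, $\sigma[\Gamma]\subseteq T$ implies $\sigma(\varphi)\in T$. A rule $\Gamma\vdash\overline\varphi$ is antiadmissible in $\mathrm L$ if for each substitution $\sigma$ and each $\Delta\subseteq\mathrm{Fm}\,\mathrm L$: if $\sigma(\overline\varphi),\Delta\vdash_{\mathrm L}\mathrm{Fm}\,\mathrm L$, then $\sigma[\Gamma],\Delta\vdash_{\mathrm L}\mathrm{Fm}\,\mathrm L$, where $\sigma(\overline\varphi)$ is obtained by applying $\sigma$ componentwise. *)

(* Defs.v *)
From mathcomp Require Import all_boot.
From mathcomp Require Import boolp classical_sets cardinality.

Set Implicit Arguments.
Unset Strict Implicit.
Unset Printing Implicit Defensive.

Local Open Scope classical_set_scope.

Record signature := Signature {
  connective : Type;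
  arity : connective -> nat
}.

(* The absolutely free algebra of signature S generated by V. *)
Inductive formula (V : Type) (S : signature) : Type :=
| Var of V
| Conn (c : connective S) of ('I_(arity c) -> formula V S).

Definition substitution V S (s : formula V S -> formula V S) : Prop :=
  forall (c : connective S) (args : 'I_(arity c) -> formula V S),
    s (@Conn V S c args) = @Conn V S c (fun i => s (args i)).

Record logic (V : Type) (S : signature) := Logic {
  entails : set (formula V S) -> formula V S -> Prop;
  infinite_variables : infinite_set [set: V];
  entails_refl : forall (G : set (formula V S)) p, G p -> entails G p;
  entails_mono : forall (G D : set (formula V S)) p,
    G `<=` D -> entails G p -> entails D p;
  entails_cut : forall (G F : set (formula V S)) q,
    (forall p, F p -> entails G p) -> entails F q -> entails G q;
  entails_struct : forall s (G : set (formula V S)) p,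
    substitution s -> entails G p -> entails (s @` G) (s p)
}.

Section Notions.
Context {V : Type} {S : signature}.
Implicit Types (L : logic V S) (G D F T : set (formula V S)).

Definition entails_set L G F : Prop := forall p, F p -> entails L G p.

Definition entails_tuple L G (I : Type) (phi : I -> formula V S) : Prop :=
  forall i, entails L G (phi i).

Definition theory L T : Prop := forall p, entails L T p -> T p.

Definition simple_theory L T : Prop :=
  [/\ theory L T, T <> setT &
      forall T', theory L T' -> T' <> setT -> T `<=` T' -> T' = T].

Definition coatomic L : Prop :=
  forall T, theory L T -> T <> setT ->
    exists2 T', simple_theory L T' & T `<=` T'.

Definition companion_entails L G p : Prop :=
  forall T s, simple_theory L T -> substitution s -> s @` G `<=` T -> T (s p).

Lemma companion_refl L G p : G p -> companion_entails L G p.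
Proof. by move=> Gp T s _ _ GT; apply: GT; exists p. Qed.

Lemma companion_mono L G D p :
  G `<=` D -> companion_entails L G p -> companion_entails L D p.
Proof.
move=> GD Gp T s sT ss DT; apply: (Gp T s sT ss) => _ [q Gq <-].
by apply: DT; exists q => //; exact: GD.
Qed.

Lemma companion_cut L G F q :
  (forall p, F p -> companion_entails L G p) ->
  companion_entails L F q -> companion_entails L G q.
Proof.
move=> GF Fq T s sT ss GT; apply: (Fq T s sT ss) => _ [p Fp <-].
exact: GF Fp T s sT ss GT.
Qed.

Lemma companion_struct L s G p :
  substitution s -> companion_entails L G p ->
  companion_entails L (s @` G) (s p).
Proof.
move=> ss Gp T r sT sr GT; apply: (Gp T (fun q => r (s q)) sT).
  by move=> c args; rewrite ss sr.
move=> _ [q Gq <-]; apply: GT; exists (s q) => //; exists q.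
Qed.

Definition semisimple_companion L : logic V S :=
  Logic (infinite_variables L) (@companion_refl L) (@companion_mono L)
    (@companion_cut L) (@companion_struct L).

(* Tuples are families over an arbitrary index type, so their length may be
   finite or infinite. *)
Definition antiadmissible L G (I : Type) (phi : I -> formula V S) : Prop :=
  forall s D, substitution s ->
    entails_set L (range (fun i => s (phi i)) `|` D) setT ->
    entails_set L (s @` G `|` D) setT.

End Notions.

(* Main.v *)
(* A simple theory T fails to contain sigma(phi) exactly when sigma(phi)
   together with T is explosive, so T itself serves as the context Delta in
   the definition of antiadmissibility. Conversely, coatomicity extends any
   non-explosive context to a simple theory, where the rule can be tested. *)
Require Import Defs.
From mathcomp Require Import all_boot.
From mathcomp Require Import boolp classical_sets cardinality.

Local Open Scope classical_set_scope.

Lemma theory_entails {V : Type} {S : signature} (L : logic V S)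
    (G : set (formula V S)) : theory L (entails L G).
Proof. by move=> p; exact: entails_cut. Qed.

Lemma theory_sub_entails {V : Type} {S : signature} (L : logic V S)
    (G T : set (formula V S)) :
  theory L T -> G `<=` T -> entails L G `<=` T.
Proof. by move=> thT GT p Gp; apply: thT; exact: entails_mono GT Gp. Qed.

(** The theory generated by [G] extends [T]; were it proper, maximality would make it equal to [T],
    forcing [G] into [T]. *)
Lemma simple_theory_explosive {V : Type} {S : signature} (L : logic V S)
    (G T : set (formula V S)) :
  simple_theory L T -> T `<=` G -> ~ G `<=` T -> entails_set L G setT.
Proof.
move=> [_ _ maxT] TG nGT.
have [GT|nGT'] := pselect (entails L G = setT).
  by move=> p _; rewrite GT.
exfalso; apply: nGT.
rewrite -(maxT _ (theory_entails L G) nGT').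
  by move=> p; exact: entails_refl.
by move=> p /TG; exact: entails_refl.
Qed.

(** Reduces explosiveness to a test against simple theories: a proper theory generated by [G] would
    lie in one. *)
Lemma coatomic_explosive {V : Type} {S : signature} (L : logic V S)
    (G : set (formula V S)) :
  coatomic L -> (forall T, simple_theory L T -> ~ G `<=` T) ->
  entails_set L G setT.
Proof.
move=> coL noT.
have [GT|nGT] := pselect (entails L G = setT).
  by move=> p _; rewrite GT.
have [T simT GT] := coL _ (theory_entails L G) nGT.
by case: (noT T simT) => p Gp; apply: GT; exact: entails_refl.
Qed.

Theorem proposition4p6 (V : Type) (S : signature) (L : logic V S)
    (Gamma : set (formula V S)) (I : Type) (phi : I -> formula V S) :
  coatomic L -> inhabited I ->
  (antiadmissible L Gamma phi <->
   entails_tuple (semisimple_companion L) Gamma phi).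
Proof.
move=> coL _; split=> [anti i T s simT ss sGT | comp s D ss expl].
  apply: contrapT => nTi.
  have [thT neT _] := simT.
  have expl : entails_set L (range (fun i => s (phi i)) `|` T) setT.
    apply: (simple_theory_explosive _ _ _ simT); first by move=> p; right.
    by move=> sub; apply: nTi; apply: sub; left; exists i.
  apply: neT; apply/seteqP; split=> // p _.
  (* [anti] makes the image of [Gamma] together with [T] explosive, but both already lie in [T]. *)
  apply: (theory_sub_entails _ _ _ thT _ _ (anti s T ss expl p Logic.I)).
  by move=> q [/sGT|].
(* A simple [T] including the image of [Gamma] and [D] would contain each [s (phi i)] by [comp],
   hence every formula by [expl]. *)
apply: (coatomic_explosive _ _ coL) => T simT sub.
have [thT neT _] := simT.
apply: neT; apply/seteqP; split=> // p _.
apply: (theory_sub_entails _ _ _ thT _ _ (expl p Logic.I)) => q [[i _ <-]|Dq].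
  by apply: (comp i T s simT ss) => r sGr; apply: sub; left.
by apply: sub; right.
Qed.
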